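(* Let $\tilde{\mathcal{O}}$ be a family of admissible domains, $\mathcal{O}\subseteq\tilde{\mathcal{O}}$ a nonempty subfamily, and let $\boldsymbol{J}=(J_1,\dots,J_l)$ be cost functionals on $\tilde{\mathcal{O}}$. Assume that for each $\Omega\in\tilde{\mathcal{O}}$ there are state problems with state spaces $\boldsymbol{V}(\Omega)=(V_1(\Omega),\dots,V_n(\Omega))$ such that each state problem has a unique solution $v_{k,\Omega}\in V_k(\Omega)$, $1\le k\le n$, and write $\boldsymbol{v}_\Omega=(v_{1,\Omega},\dots,v_{n,\Omega})$. Suppose that the following two assumptions hold. (i) Compactness of $\mathcal{G}=\{(\Omega,\boldsymbol{v}_\Omega):\Omega\in\mathcal{O}\}$: every sequence $(\Omega_m,\boldsymbol{v}_{\Omega_m})_{m\in\mathbb{N}}$ in $\mathcal{G}$ has a subsequence $(\Omega_{m_k},\boldsymbol{v}_{\Omega_{m_k}})_{k\in\mathbb{N}}$ such that, for some $(\Omega,\boldsymbol{v}_\Omega)\in\mathcal{G}$, $\Omega_{m_k}\overset{\tilde{\mathcal{O}}}{\longrightarrow}\Omega$ and $\boldsymbol{v}_{\Omega_{m_k}}\rightsquigarrow\boldsymbol{v}_\Omega$ as $k\to\infty$. (ii) Lower semicontinuity: whenever $(\Omega_m)_{m\in\mathbb{N}}$ is a sequence in $\tilde{\mathcal{O}}$, $(\boldsymbol{y}_m)_{m\in\mathbb{N}}$ is a sequence with $\boldsymbol{y}_m\in\boldsymbol{V}(\Omega_m)$ for all $m$, and $\Omega\in\tilde{\mathcal{O}}$,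 $\boldsymbol{y}\in\boldsymbol{V}(\Omega)$ satisfy $\Omega_m\overset{\tilde{\mathcal{O}}}{\longrightarrow}\Omega$ and $\boldsymbol{y}_m\rightsquigarrow\boldsymbol{y}$ as $m\to\infty$, then $\liminf_{m\to\infty}J_k(\Omega_m,\boldsymbol{y}_m)\ge J_k(\Omega,\boldsymbol{y})$ for all $1\le k\le l$. Then the multi criteria shape design problem ''find $\Omega^*\in\mathcal{O}$ such that $(\Omega^*,\boldsymbol{v}_{\Omega^*})$ is Pareto optimal with respect to $\boldsymbol{J}$'' possesses at least one solution, and the Pareto front covers all nondominated points of $\mathrm{cl}(\mathcal{Y})$, where $\mathcal{Y}=\boldsymbol{J}(\mathcal{G})\subset\mathbb{R}^l$; that is, $\mathcal{Y}_N=\mathrm{cl}(\mathcal{Y})_N$.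
   Context: Setting. $\tilde{\mathcal{O}}$ is a family of shapes (domains) equipped with a topology; $\Omega_m\overset{\tilde{\mathcal{O}}}{\longrightarrow}\Omega$ denotes convergence in it. For each $\Omega\in\tilde{\mathcal{O}}$, $V_1(\Omega),\dots,V_n(\Omega)$ are spaces of real valued functions on $\Omega$ (state spaces); $\boldsymbol{y}\in\boldsymbol{V}(\Omega)$ means $\boldsymbol{y}\in V_1(\Omega)\times\dots\times V_n(\Omega)$. A notion of convergence, denoted $\boldsymbol{y}_m\rightsquigarrow\boldsymbol{y}$, is given for sequences $\boldsymbol{y}_m\in\boldsymbol{V}(\Omega_m)$ (functions on varying domains) towards $\boldsymbol{y}\in\boldsymbol{V}(\Omega)$. A state problem on $\Omega$ is, e.g., a PDE or variational inequality; here it matters only that it assigns to each $\Omega\in\tilde{\mathcal{O}}$ a unique solution $v_{i,\Omega}\in V_i(\Omega)$. A cost functional $J$ on $\tilde{\mathcal{O}}$ is a map $(\Omega,\boldsymbol{y})\mapsto J(\Omega,\boldsymbol{y})\in\mathbb{R}$ defined for $\Omega\in\tilde{\mathcal{O}}$ and $\boldsymbol{y}\in\boldsymbol{V}(\Omega)$. Write $\boldsymbol{J}(\Omega,\boldsymbol{v}_\Omega)=(J_1(\Omega,\boldsymbol{v}_\Omega),\dots,J_l(\Omega,\boldsymbol{v}_\Omega))$. Pareto optimality. A point $(\Omega^*,\boldsymbol{v}_{\Omega^*})\in\mathcal{G}$ is Pareto optimal with respect to $\boldsymbol{J}$ if there is no $(\Omega,\boldsymbol{v}_\Omega)\in\mathcal{G}$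 with $J_k(\Omega,\boldsymbol{v}_\Omega)\le J_k(\Omega^*,\boldsymbol{v}_{\Omega^*})$ for all $1\le k\le l$ and $J_i(\Omega,\boldsymbol{v}_\Omega)<J_i(\Omega^*,\boldsymbol{v}_{\Omega^*})$ for some $i$; the value $\boldsymbol{J}(\Omega^*,\boldsymbol{v}_{\Omega^*})$ is then called nondominated. For a set $A\subseteq\mathbb{R}^l$, $A_N$ denotes the set of nondominated points of $A$, i.e. those $a\in A$ for which there is no $b\in A$ with $b_k\le a_k$ for all $k$ and $b_i<a_i$ for some $i$. $\mathcal{Y}_N$ is the Pareto front, and $\mathrm{cl}$ is the closure in $\mathbb{R}^l$. *)

(* Defs.v *)
From mathcomp Require Import all_boot all_order all_algebra.
From mathcomp Require Import all_classical all_reals all_analysis.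

Set Implicit Arguments.
Unset Strict Implicit.
Unset Printing Implicit Defensive.

Import Order.TTheory GRing.Theory Num.Theory.
Import numFieldNormedType.Exports.

Local Open Scope classical_set_scope.
Local Open Scope ring_scope.

(* The family of shapes is a topological space [Ot] of shape labels, each label
   [Om] standing for the subset [dom Om] of an ambient type [E].  [V Om i] is a
   set of functions on the subtype [dom Om], so that an inhabitant of the type
   below is a tuple y in V_1(Om) x ... x V_n(Om). *)
Definition state_vector (R : realType) (E : Type) (n : nat)
    (Ot : topologicalType) (dom : Ot -> set E)
    (V : forall Om : Ot, 'I_n -> set (dom Om -> R)) (Om : Ot) : Type :=
  forall i : 'I_n, V Om i.

(* Pairs (Om, y) with y in V(Om): the domain of the cost functionals.  A
   sequence of such pairs is a sequence of shapes [projT1 (p m)] together with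
   functions living on these varying shapes. *)
Definition shape_state (R : realType) (E : Type) (n : nat)
    (Ot : topologicalType) (dom : Ot -> set E)
    (V : forall Om : Ot, 'I_n -> set (dom Om -> R)) : Type :=
  {Om : Ot & state_vector V Om}.

Definition solution_graph (R : realType) (E : Type) (n : nat)
    (Ot : topologicalType) (dom : Ot -> set E)
    (V : forall Om : Ot, 'I_n -> set (dom Om -> R))
    (v : forall Om : Ot, state_vector V Om) (O : set Ot) :
    set (shape_state V) :=
  [set existT _ Om (v Om) | Om in O].

Definition cost_vector (R : realType) (X : Type) (l : nat)
    (J : 'I_l -> X -> R) (p : X) : 'rV[R]_l :=
  \row_(k < l) J k p.

Definition dominates (R : realType) (l : nat) (b a : 'rV[R]_l) : Prop :=
  (forall k, b 0 k <= a 0 k) /\ (exists i, b 0 i < a 0 i).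

Definition nondominated (R : realType) (l : nat) (A : set 'rV[R]_l) :
    set 'rV[R]_l :=
  [set a | A a /\ ~ exists2 b, A b & dominates b a].

Definition pareto_optimal (R : realType) (X : Type) (l : nat)
    (J : 'I_l -> X -> R) (G : set X) (p : X) : Prop :=
  G p /\ ~ exists2 q, G q & dominates (cost_vector J q) (cost_vector J p).

(* [conv p q] stands for the convergence of the function components of the
   pairs [p m] to that of [q]. *)
Definition shape_sequentially_compact (R : realType) (E : Type) (n : nat)
    (Ot : topologicalType) (dom : Ot -> set E)
    (V : forall Om : Ot, 'I_n -> set (dom Om -> R))
    (conv : (nat -> shape_state V) -> shape_state V -> Prop)
    (G : set (shape_state V)) : Prop :=
  forall p : nat -> shape_state V, (forall m, G (p m)) ->
  exists (f : nat -> nat) (q : shape_state V),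
    [/\ {homo f : i j / (i < j)%N}, G q,
        projT1 (p (f k)) @[k --> \oo] --> projT1 q &
        conv (fun k => p (f k)) q].

Definition shape_lower_semicontinuous (R : realType) (E : Type) (n : nat)
    (Ot : topologicalType) (dom : Ot -> set E)
    (V : forall Om : Ot, 'I_n -> set (dom Om -> R))
    (conv : (nat -> shape_state V) -> shape_state V -> Prop)
    (J : shape_state V -> R) : Prop :=
  forall (p : nat -> shape_state V) (q : shape_state V),
    projT1 (p m) @[m --> \oo] --> projT1 q -> conv p q ->
    ((J q)%:E <= limn_einf (fun m => (J (p m))%:E))%E.

(* Main.v *)
Require Import Defs.
From mathcomp Require Import all_boot all_order all_algebra.
From mathcomp Require Import all_classical all_reals all_analysis.
From mathcomp Require Import lra.

(** Compactness and lower semicontinuity say together that every sequence [p]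
    in the graph [G] has a point [q] of [G] whose costs are asymptotically no
    larger than those of [p], along a subsequence and for all criteria at once
    ([lsc_recurrently_bounded]).  Both conclusions follow from this property of
    the cost vector alone ([recurrently_bounded]).

    A Pareto optimal point is found by minimizing the sum of the criteria over
    [G].  A minimizing sequence has such a point [q], and its total cost is at
    most the infimum, which is thereby seen to be finite and attained
    ([total_cost_minimum]).  A point dominating [q] would have a strictly
    smaller total cost.

    For the Pareto front, the key fact is that every point [a] of the closure of
    [Y] lies above some point of [Y] ([closure_cost_above]): take [q] for a
    sequence whose costs converge to [a].  Hence a point of the closure that is
    nondominated there coincides with the point of [Y] below it, and a point of
    [Y] dominated by a point of the closure is dominated by a point of [Y]. *)

Set Implicit Arguments.
Unset Strict Implicit.
Unset Printing Implicit Defensive.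

Import Order.TTheory GRing.Theory Num.Theory.
Import numFieldNormedType.Exports.

Local Open Scope classical_set_scope.
Local Open Scope ring_scope.

Lemma lt_limn_einf_near (R : realType) (u : (\bar R)^nat) (x : \bar R) :
  (x < limn_einf u)%E -> \forall n \near \oo, (x < u n)%E.
Proof.
rewrite limn_einf_lim => xu.
have /(_ [set y | (x < y)%E]) := @is_cvg_einfs R u.
have : nbhs (limn (einfs u)) [set y | (x < y)%E].
  by apply: open_nbhs_nbhs; split => //; exact: open_ereal_gt_ereal.
move=> /[swap] /[apply] -[N _ xuN]; exists N => // n /= Nn.
apply: lt_le_trans (xuN N (leqnn N)) _.
by apply: ereal_inf_lbound; exists n.
Qed.

(** What compactness and lower semicontinuity leave of a sequence in [G]: the
    bound holds for all criteria at the same index [m], and [m] can be taken in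
    any set [P] containing all large indices, so that properties of the tail of [p] can
    be combined with it. *)
Definition recurrently_bounded (R : realType) (X : Type) (l : nat)
    (J : 'I_l -> X -> R) (G : set X) : Prop :=
  forall p : nat -> X, (forall m, G (p m)) ->
  exists2 q, G q & forall (e : R) (P : set nat), 0 < e ->
    (\forall m \near \oo, P m) ->
    exists2 m, P m & forall k, J k q < J k (p m) + e.

Lemma lsc_recurrently_bounded (R : realType) (E : Type) (n l : nat)
    (Ot : topologicalType) (dom : Ot -> set E)
    (V : forall Om : Ot, 'I_n -> set (dom Om -> R))
    (conv : (nat -> shape_state V) -> shape_state V -> Prop)
    (J : 'I_l -> shape_state V -> R) (G : set (shape_state V)) :
  shape_sequentially_compact conv G ->
  (forall k, shape_lower_semicontinuous conv (J k)) ->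
  recurrently_bounded J G.
Proof.
move=> Gcompact Jlsc p Gp.
have [f [q [f_incr Gq shape_cvg state_cvg]]] := Gcompact p Gp.
exists q => // e P e0 [N _ PN].
have Jq_near k : \forall j \near \oo, J k q < J k (p (f j)) + e.
  have /lt_limn_einf_near : ((J k q - e)%:E <
      limn_einf (fun j => (J k (p (f j)))%:E))%E.
    by apply: lt_le_trans (Jlsc k _ _ shape_cvg state_cvg); rewrite lte_fin; lra.
  by apply: filterS => j /=; rewrite lte_fin ltrBlDr.
have /filter_forall[M _ Jq_all] := Jq_near.
have f_ge j : (j <= f j)%N.
  by elim: j => // j jfj; apply: leq_ltn_trans jfj _; exact: f_incr.
exists (f (maxn N M)); first exact/PN/(leq_trans (leq_maxl _ _) (f_ge _)).
by move=> k; apply: Jq_all; rewrite /= leq_maxr.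
Qed.

Section RecurrentlyBounded.
Variables (R : realType) (X : Type) (l : nat).
Variables (J : 'I_l -> X -> R) (G : set X).
Hypothesis J_bounded : recurrently_bounded J G.

Let total_cost (p : X) : R := \sum_k J k p.

(** The infimum is taken in the extended reals, so that boundedness from below
    need not be proved beforehand. *)
Lemma total_cost_minimum : G !=set0 ->
  exists2 q, G q & forall p, G p -> total_cost q <= total_cost p.
Proof.
move=> [p0 Gp0]; set S := [set (total_cost p)%:E | p in G].
have S0 : S != set0 by apply/set0P; exists (total_cost p0)%:E, p0.
have [u Su u_inf] := ereal_inf_seq S0.
have /choice[p Gp_u] i : exists x, G x /\ (total_cost x)%:E = u i.
  by have [x Gx xu] := Su i; exists x.
have [q Gq q_bounded] := J_bounded (fun i => (Gp_u i).1).
exists q => // x Gx; rewrite leNgt; apply/negP => xq.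
set d := (total_cost q - total_cost x) / 2.
have d0 : 0 < d by rewrite /d; lra.
have inf_lt : (ereal_inf S < (total_cost x + d)%:E)%E.
  apply: (@le_lt_trans _ _ (total_cost x)%:E); last by rewrite lte_fin; lra.
  by apply: ereal_inf_lbound; exists x.
have near_lt : \forall m \near \oo, total_cost (p m) < total_cost x + d.
  have : nbhs (ereal_inf S) [set y | (y < (total_cost x + d)%:E)%E].
    by apply: open_nbhs_nbhs; split => //; exact: open_ereal_lt_ereal.
  move=> /u_inf[N _ u_lt]; exists N => // m /u_lt /=.
  by rewrite -(Gp_u m).2 lte_fin.
(* The error [d] is shared out among the [l] criteria. *)
have e0 : 0 < d / l.+1%:R by rewrite divr_gt0.
have [m pm_lt q_lt] := q_bounded _ _ e0 near_lt.
have : total_cost q <= total_cost (p m) + d.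
  apply: (@le_trans _ _ (\sum_k (J k (p m) + d / l.+1%:R))).
    by apply: ler_sum => k _; exact/ltW/q_lt.
  rewrite big_split /= lerD2l sumr_const card_ord -[_ *+ l]mulr_natr.
  by rewrite -mulrA ler_piMr ?(ltW d0)// mulrC ler_pdivrMr// mul1r ler_nat.
by rewrite /d in pm_lt *; lra.
Qed.

Lemma pareto_optimal_exists : G !=set0 -> exists q, pareto_optimal J G q.
Proof.
move=> /total_cost_minimum[q Gq q_min]; exists q; split => // -[x Gx [x_le]].
move=> [i x_lt]; have := q_min x Gx; rewrite leNgt => /negP; apply.
rewrite /total_cost (bigD1 i)//= [ltRHS](bigD1 i)//= ltr_leD//.
  by move: x_lt; rewrite !mxE.
by apply: ler_sum => k _; have := x_le k; rewrite !mxE.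
Qed.

Let Y : set 'rV[R]_l := [set cost_vector J p | p in G].

Lemma closure_cost_above (a : 'rV[R]_l) : closure Y a ->
  exists2 b, Y b & forall k, b 0 k <= a 0 k.
Proof.
move=> aY.
have /choice[p pP] m : exists p, G p /\ ball a m.+1%:R^-1 (cost_vector J p).
  have m0 : 0 < m.+1%:R^-1 :> R by rewrite invr_gt0.
  by have [_ [[p Gp <-] ap]] := aY _ (nbhsx_ballx a _ m0); exists p.
have [q Gq q_bounded] := J_bounded (fun m => (pP m).1).
exists (cost_vector J q); first by exists q.
move=> k; rewrite mxE.
suff : forall e : R, 0 < e -> J k q <= a 0 k + e by move/ler_addgt0Pr.
move=> e e0.
have e20 : 0 < e / 2 by rewrite divr_gt0.
have [m m_lt /(_ k) q_lt] :=
  q_bounded _ _ e20 (near_infty_natSinv_lt (PosNum e20)).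
have {}m_lt : m.+1%:R^-1 < e / 2 := m_lt.
have [_ [_ /(_ 0 k)]] := pP m.
rewrite /ball /= mxE ltr_norml => /andP[am _].
by move: (m.+1%:R^-1) m_lt am => d m_lt am; lra.
Qed.

Lemma nondominated_closure : nondominated Y = nondominated (closure Y).
Proof.
apply/seteqP; split => a [Ya a_nd].
- split; first exact: subset_closure.
  move=> [b /closure_cost_above[c Yc cb] [ba [i bai]]]; apply: a_nd.
  exists c => //; split; last by exists i; exact: le_lt_trans bai.
  by move=> k; exact: le_trans (ba k).
- have [b Yb ba] := closure_cost_above Ya.
  have ab : a = b.
    apply/rowP => k; apply/eqP; rewrite eq_le ba andbT leNgt.
    apply/negP => bak; apply: a_nd.
    by exists b; [exact: subset_closure|split => //; exists k].
  split; first by rewrite ab.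
  by move=> [c Yc ca]; apply: a_nd; exists c => //; exact: subset_closure.
Qed.

End RecurrentlyBounded.

Theorem theorem3p3 (R : realType) (E : Type) (n l : nat)
  (Ot : topologicalType) (dom : Ot -> set E)
  (V : forall Om : Ot, 'I_n -> set (dom Om -> R))
  (conv : (nat -> shape_state V) -> shape_state V -> Prop)
  (solves : forall (Om : Ot) (k : 'I_n), set (V Om k))
  (v : forall Om : Ot, state_vector V Om)
  (v_unique_solution : forall (Om : Ot) (k : 'I_n),
     unique (solves Om k) (v Om k))
  (O : set Ot) (O_nonempty : O !=set0)
  (J : 'I_l -> shape_state V -> R)
  (G_compact : shape_sequentially_compact conv (solution_graph v O))
  (J_lsc : forall k : 'I_l, shape_lower_semicontinuous conv (J k)) :
  let G := solution_graph v O in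
  let Y := [set cost_vector J p | p in G] in
  (exists2 Om : Ot, O Om & pareto_optimal J G (existT _ Om (v Om))) /\
  nondominated Y = nondominated (closure Y).
Proof.
move=> G Y.
have J_bounded := lsc_recurrently_bounded G_compact J_lsc.
split; last exact: nondominated_closure.
have G0 : G !=set0 by have [Om OOm] := O_nonempty; exists (existT _ Om (v Om)), Om.
have [q q_opt] := pareto_optimal_exists J_bounded G0.
have [[Om OOm qE] _] := q_opt.
by exists Om => //; rewrite qE.
Qed.
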